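(* There is an absolute constant $C>0$ such that for all integers $2\le k\le n$ there exists a map $\phi:\mathcal{H}_n^k\to\mathcal{H}_k(n)$ such that for all $\vec x,\vec y\in\mathcal{H}_n^k$, \[\tfrac12\operatorname{Ham}(\vec x,\vec y)\le \operatorname{Ham}(\phi(\vec x),\phi(\vec y))\le C\log n\,\log k\;\operatorname{Ham}(\vec x,\vec y).\]
   Context: $\mathcal{H}_n^k$ is the set of vectors in $\{0,1\}^n$ with exactly $k$ coordinates equal to $1$. $\mathcal{H}_k(n)$ is the set of $k$-dimensional vectors with entries from $[n]=\{1,\dots,n\}$. For two vectors $\vec x,\vec y$ of the same dimension, $\operatorname{Ham}(\vec x,\vec y)=|\{i: x_i\ne y_i\}|$. *)

(* Defs.v *)
From HB Require Import structures.
From mathcomp Require Import all_boot all_order all_algebra.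
From mathcomp Require Import reals exp.

Set Implicit Arguments.
Unset Strict Implicit.
Unset Printing Implicit Defensive.

Definition Ham (d : nat) (T : eqType) (x y : {ffun 'I_d -> T}) : nat :=
  #|[set i | x i != y i]|.

(* The slice H_n^k of the Boolean cube; [true] encodes the coordinate 1. *)
Definition slice (n k : nat) : Type :=
  {x : {ffun 'I_n -> bool} | #|[set i | x i]| == k}.

(* The space H_k(n) of k-dimensional vectors over [n]; the n-letter alphabet
   {1, .., n} is represented by 'I_n, i.e. shifted down by one. *)
Definition hamming_space (k n : nat) : Type := {ffun 'I_k -> 'I_n}.

(* Main.v *)
Require Import Defs.
From HB Require Import structures.
From mathcomp Require Import all_boot all_order all_algebra.
From mathcomp Require Import reals exp.
From mathcomp Require Import zify.

Set Implicit Arguments.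
Unset Strict Implicit.
Unset Printing Implicit Defensive.

(* [phi x] lists the support of [x] without repetition; this alone gives the
   lower bound, since two listings agree in at most as many slots as the
   supports have common elements.  The listing comes from a fixed sequence of
   rounds.  A round hashes the n elements and the k slots to common addresses,
   and at every address holding both an unplaced element and a free slot it
   puts the least such element in the least such slot.  The number of places
   where two runs differ never grows, so that each round contributes at most
   2 Ham(x, y) differing slots, and it remains to place everything in
   O(log n log k) rounds.

   If at most 40q elements remain and hashing is into 4q addresses, a random
   hash sends a fixed set of 20q elements to at most 3q addresses with
   probability at most 2^(-4q).  A union bound over the n^O(q) pairs (W, Z) of
   20q elements and 20q slots gives a block of O(log n) rounds such that every
   pair has a round in which both images have more than 3q of the 4q addresses.
   The union bound need not follow the run: if 20q elements W and slots Z
   survive a block, they were present in all its rounds, and the round good for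
   (W, Z) matched at least 2q pairs.  Hence 10 repetitions of the block halve
   the bound on the number of remaining elements; the last 20 are placed by
   rounds with a single address. *)

(** * Symmetric differences and removal of least elements *)

Definition symdiff (T : finType) (X Y : {set T}) : {set T} :=
  (X :\: Y) :|: (Y :\: X).

Lemma in_symdiff (T : finType) (X Y : {set T}) i :
  (i \in symdiff X Y) = ((i \in X) != (i \in Y)).
Proof. by rewrite !inE; case: (i \in X); case: (i \in Y). Qed.

Lemma symdiffC (T : finType) (X Y : {set T}) : symdiff X Y = symdiff Y X.
Proof. by rewrite /symdiff setUC. Qed.

Lemma symdiffv (T : finType) (X : {set T}) : symdiff X X = set0.
Proof. by apply/setP=> i; rewrite in_symdiff inE eqxx. Qed.

Lemma symdiff_eq0 (T : finType) (X Y : {set T}) :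
  #|symdiff X Y| = 0 -> X = Y.
Proof.
move/eqP; rewrite cards_eq0 => /eqP XY; apply/setP=> i; apply/eqP.
by have := in_symdiff X Y i; rewrite XY inE => /esym/negbFE.
Qed.

Section Minset.
Variable m : nat.
Implicit Types X Y : {set 'I_m}.

(** A set with at most one element, so that the empty set needs no default value. *)
Definition minset X := [set i in X | [forall j in X, i <= j]].

Lemma minset_uniq X i j : i \in minset X -> j \in minset X -> i = j.
Proof.
rewrite !inE => /andP[iX /forall_inP imin] /andP[jX /forall_inP jmin].
by apply/val_inj/eqP; rewrite eqn_leq imin ?jmin.
Qed.

Lemma minset_sub X : minset X \subset X.
Proof. by apply/subsetP=> i; rewrite inE => /andP[]. Qed.

Variant minset_spec X : {set 'I_m} -> bool -> Prop :=
| MinsetEmpty of X = set0 : minset_spec X set0 false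
| MinsetSome i of i \in X & (forall j, j \in X -> i <= j) :
    minset_spec X [set i] true.

Lemma minsetP X : minset_spec X (minset X) (X != set0).
Proof.
have [->|X0] := eqVneq X set0.
  have -> : minset set0 = set0 by apply/setP=> i; rewrite !inE.
  exact: MinsetEmpty.
case/set0Pn: X0 => i0 i0X; case: (arg_minnP val i0X) => i iX imin.
have -> : minset X = [set i].
  have iM : i \in minset X by rewrite inE; apply/andP; split; last exact/forall_inP.
  apply/setP=> j; rewrite in_set1; apply/idP/eqP => [jM|-> //].
  exact: minset_uniq jM iM.
exact: MinsetSome.
Qed.

Lemma card_minset X : #|minset X| = (X != set0).
Proof. by case: minsetP => [_|i _ _]; rewrite ?cards0 ?cards1. Qed.

Definition behead_set X := X :\: minset X.

Lemma card_behead_set X : #|behead_set X| = #|X|.-1.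
Proof.
rewrite /behead_set cardsD (setIidPr (minset_sub X)) card_minset -subn1.
by case: eqVneq => [->|_]; rewrite ?cards0.
Qed.

Lemma symdiff_behead1 X Y :
  #|symdiff (behead_set X) Y| <= #|symdiff X Y|.+1.
Proof.
have -> : #|symdiff X Y|.+1 = #|symdiff X Y| + 1 by rewrite addn1.
have le1 : #|minset X| <= 1 by rewrite card_minset leq_b1.
apply: leq_trans (leq_add (leqnn _) le1).
apply: leq_trans (leq_card_setU _ _); apply: subset_leq_card.
apply/subsetP=> i; rewrite in_setU !in_symdiff /behead_set in_setD.
by case: (i \in minset X); rewrite ?orbT ?orbF.
Qed.

(** If the minima are [x < y], then [x] is not in [Y]: its removal takes [x] out of the symmetric
    difference, and only [y] can enter. *)
Lemma symdiff_behead2 X Y : X != set0 -> Y != set0 ->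
  #|symdiff (behead_set X) (behead_set Y)| <= #|symdiff X Y|.
Proof.
move=> X0 Y0; rewrite /behead_set.
case: minsetP X0 => // x xX xmin _; case: minsetP Y0 => // y yY ymin _.
wlog le_xy: X Y x y xX xmin yY ymin / x <= y.
  move=> W; case: (leqP x y) => [|/ltnW] le; first exact: W.
  by rewrite symdiffC (symdiffC X); apply: W.
move: le_xy; rewrite leq_eqVlt => /orP[/eqP/val_inj xy|lt_xy].
  subst y; apply: subset_leq_card; apply/subsetP=> i.
  by rewrite !in_symdiff !in_setD; case: (i \in [set x]).
have xNY : x \notin Y by apply/negP=> /ymin; rewrite leqNgt lt_xy.
have xS : x \in symdiff X Y by rewrite in_symdiff xX (negbTE xNY).
rewrite (cardsD1 x (symdiff X Y)) xS add1n -addn1 -(cards1 y).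
apply: leq_trans (leq_card_setU _ _); apply: subset_leq_card.
apply/subsetP=> i; rewrite !in_setU in_setD1 !in_symdiff !in_setD !in_set1.
case: (eqVneq i x) => [->|_] /=; first by rewrite (negbTE xNY) ?eqxx ?andbF.
by case: (i == y); case: (i \in X); case: (i \in Y).
Qed.

End Minset.

(** * One round of matching by addresses *)

Definition fiber m w (h : 'I_m -> 'I_w) (X : {set 'I_m}) c :=
  [set i in X | h i == c].

Lemma in_fiber m w (h : 'I_m -> 'I_w) (X : {set 'I_m}) c i :
  (i \in fiber h X c) = (i \in X) && (h i == c).
Proof. by rewrite inE. Qed.

Lemma card_fibers m w (h : 'I_m -> 'I_w) (X : {set 'I_m}) :
  #|X| = \sum_c #|fiber h X c|.
Proof.
rewrite -sum1_card (partition_big h xpredT) //=; apply: eq_bigr => c _.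
by rewrite -sum1_card; apply: eq_bigl => i; rewrite inE.
Qed.

Lemma fiber_symdiff m w (h : 'I_m -> 'I_w) (X Y : {set 'I_m}) c :
  fiber h (symdiff X Y) c = symdiff (fiber h X c) (fiber h Y c).
Proof.
apply/setP=> i; rewrite in_symdiff !inE.
by case: (h i == c); case: (i \in X); case: (i \in Y).
Qed.

Section Rest.
Variables (m l w : nat) (h : 'I_m -> 'I_w) (g : 'I_l -> 'I_w).
Implicit Types (X : {set 'I_m}) (Y : {set 'I_l}).

(* [X] without its least element at each address also occupied by [Y]. *)
Definition rest X Y :=
  [set i in X | ~~ ((i \in minset (fiber h X (h i)))
                    && (fiber g Y (h i) != set0))].

Lemma fiber_rest X Y c :
  fiber h (rest X Y) c =
    if fiber g Y c != set0 then behead_set (fiber h X c) else fiber h X c.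
Proof.
apply/setP=> i; rewrite /rest /behead_set [in LHS]inE [in X in X && _]inE.
case: (eqVneq (h i) c) => [<-|hic]; last first.
  by rewrite andbF; case: ifP => _; rewrite !inE (negbTE hic) ?andbF.
by case: ifP => _; rewrite ?andbF ?andbT ?in_setD in_fiber eqxx andbT // andbC.
Qed.

(** Exactly one element disappears at each address common to both images. *)
Lemma card_rest X Y : #|rest X Y| + #|h @: X :&: g @: Y| = #|X|.
Proof.
rewrite (card_fibers h (rest _ _)) (card_fibers h X).
rewrite -sum1_card [X in _ + X]big_mkcond -big_split /=; apply: eq_bigr => c _.
have imE p (f : 'I_p -> 'I_w) (Z : {set _}) : (c \in f @: Z) = (fiber f Z c != set0).
  apply/imsetP/set0Pn => [[i iZ ->]|[i]]; first by exists i; rewrite inE iZ /=.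
  by rewrite in_fiber => /andP[iZ /eqP <-]; exists i.
rewrite fiber_rest inE !imE; case: (fiber g Y c != set0); last first.
  by rewrite andbF addn0.
rewrite andbT card_behead_set -cards_eq0 -lt0n.
by case: (#|_|) => //= p; rewrite addn1.
Qed.

End Rest.

(** The bound holds address by address. If just one run matches there, the other has an empty side.
    On that side the difference drops by one, which pays for a growth of at most one on the opposite
    side. *)
Lemma rest_lipschitz m l w (h : 'I_m -> 'I_w) (g : 'I_l -> 'I_w)
    (X X' : {set 'I_m}) (Y Y' : {set 'I_l}) :
  #|symdiff (rest h g X Y) (rest h g X' Y')|
    + #|symdiff (rest g h Y X) (rest g h Y' X')|
  <= #|symdiff X X'| + #|symdiff Y Y'|.
Proof.
rewrite (card_fibers h (symdiff (rest _ _ _ _) _)) (card_fibers h (symdiff X _)).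
rewrite (card_fibers g (symdiff (rest _ _ _ _) _)) (card_fibers g (symdiff Y _)).
rewrite -!big_split /=; apply: leq_sum => c _; rewrite !fiber_symdiff !fiber_rest.
move: (fiber h X c) (fiber h X' c) (fiber g Y c) (fiber g Y' c).
move=> {}X {}X' {}Y {}Y'.
have emptyE p (Z : {set 'I_p}) : Z != set0 ->
    #|symdiff (behead_set Z) set0| + 1 <= #|symdiff Z set0|.
  move=> Z0; rewrite /symdiff !setD0 !set0D !setU0 card_behead_set addn1.
  by rewrite prednK ?card_gt0.
have bh0 p : behead_set (set0 : {set 'I_p}) = set0.
  by rewrite /behead_set set0D.
have half p q (A A' : {set 'I_p}) (B B' : {set 'I_q}) :
    (A' == set0) || (B' == set0) -> A != set0 -> B != set0 ->
    #|symdiff (behead_set A) A'| + #|symdiff (behead_set B) B'|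
      <= #|symdiff A A'| + #|symdiff B B'|.
  move=> /orP[]/eqP -> A0 B0.
    by have := emptyE _ _ A0; have := symdiff_behead1 B B'; lia.
  by have := emptyE _ _ B0; have := symdiff_behead1 A A'; lia.
(* Beheading the empty set changes nothing, so both sides can be given the same condition: a match
   takes place. *)
have restE p q (A : {set 'I_p}) (B : {set 'I_q}) :
    (if B != set0 then behead_set A else A) =
    if (A != set0) && (B != set0) then behead_set A else A.
  by case: (eqVneq A set0) => [->|//]; rewrite bh0 if_same.
rewrite !(restE m) !(restE l) [(Y != _) && _]andbC [(Y' != _) && _]andbC.
case: (boolP ((X != set0) && (Y != set0))) => [/andP[X0 Y0]|nXY];
  case: (boolP ((X' != set0) && (Y' != set0))) => [/andP[X0' Y0']|nXY'] //.
- by apply: leq_add; apply: symdiff_behead2.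
- by apply: half => //; move: nXY'; rewrite negb_and !negbK.
- rewrite symdiffC (symdiffC Y) (symdiffC X) (symdiffC Y).
  by apply: half => //; move: nXY; rewrite negb_and !negbK.
Qed.

(** * The assignment made by a sequence of rounds, and its stability *)

Section Assignment.
Variables n k : nat.
Implicit Types (U : {set 'I_n}) (F : {set 'I_k}).

(** The width is a field, so that one sequence can mix rounds with different numbers of
    addresses. *)
Record round := Round {
  width : nat;
  lhash : 'I_n -> 'I_width;
  rhash : 'I_k -> 'I_width }.

Implicit Types (r : round) (rs : seq round).

Definition matched r U F (e : 'I_n) (s : 'I_k) : bool :=
  [&& lhash r e == rhash r s,
      e \in minset (fiber (lhash r) U (lhash r e))
    & s \in minset (fiber (rhash r) F (rhash r s))].

Definition lrest r U F := rest (lhash r) (rhash r) U F.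
Definition rrest r U F := rest (rhash r) (lhash r) F U.

Fixpoint assign rs U F (s : 'I_k) : option 'I_n :=
  if rs is r :: rs' then
    if [pick e | matched r U F e s] is Some e then Some e
    else assign rs' (lrest r U F) (rrest r U F) s
  else None.

Fixpoint run rs U F : {set 'I_n} * {set 'I_k} :=
  if rs is r :: rs' then run rs' (lrest r U F) (rrest r U F) else (U, F).

Lemma matched_mem r U F e s : matched r U F e s ->
  [/\ e \in U, s \in F, e \notin lrest r U F & s \notin rrest r U F].
Proof.
case/and3P=> /eqP es eM sM.
have := subsetP (minset_sub _) _ eM; rewrite in_fiber => /andP[eU _].
have := subsetP (minset_sub _) _ sM; rewrite in_fiber => /andP[sF _].
split=> //; rewrite inE ?eU ?sF ?eM ?sM /= negbK.
  by apply/set0Pn; exists s; rewrite in_fiber sF es /=.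
by apply/set0Pn; exists e; rewrite in_fiber eU es /=.
Qed.

Lemma lrest_sub r U F : lrest r U F \subset U.
Proof. by apply/subsetP=> e; rewrite inE => /andP[]. Qed.

Lemma rrest_sub r U F : rrest r U F \subset F.
Proof. by apply/subsetP=> e; rewrite inE => /andP[]. Qed.

Lemma matched_inj r U F e s s' :
  matched r U F e s -> matched r U F e s' -> s = s'.
Proof.
case/and3P=> /eqP es _ sM /and3P[/eqP es' _ s'M].
by apply: minset_uniq sM _; rewrite -es es'.
Qed.

Lemma assign_mem rs U F s e :
  assign rs U F s = Some e -> e \in U /\ s \in F.
Proof.
elim: rs U F => //= r rs IH U F.
case: pickP => [e' /matched_mem[eU sF _ _] [<-]|_ /IH[eU sF]] //.
by rewrite (subsetP (lrest_sub r U F)) ?(subsetP (rrest_sub r U F)).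
Qed.

(** A placed element leaves the remaining set, so no later round can place it again. *)
Lemma assign_inj rs U F s s' e :
  assign rs U F s = Some e -> assign rs U F s' = Some e -> s = s'.
Proof.
elim: rs U F => //= r rs IH U F.
case: pickP => [e1 m1 [e1e]|_ a1]; case: pickP => [e2 m2 [e2e]|_ a2].
- by move: m1 m2; rewrite e1e e2e; apply: matched_inj.
- by case: (matched_mem m1) => _ _; rewrite e1e (assign_mem a2).1.
- by case: (matched_mem m2) => _ _; rewrite e2e (assign_mem a1).1.
- exact: IH a1 a2.
Qed.

Lemma assign_run rs U F s :
  s \in F -> s \notin (run rs U F).2 -> exists e, assign rs U F s = Some e.
Proof.
elim: rs U F => /= [|r rs IH] U F sF; first by rewrite sF.
case: pickP => [e _ _|nm]; first by exists e.
apply: IH; rewrite inE sF /=; apply/negP=> /andP[sM].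
case: minsetP (minset_uniq (X := fiber (lhash r) U (rhash r s))) => //.
move=> e; rewrite in_fiber => /andP[eU /eqP es] emin _ _.
have /negP[] := nm e; rewrite /matched es eqxx sM andbT /=.
by rewrite inE in_fiber eU es eqxx; apply/forall_inP.
Qed.

Definition discrepancy U F U' F' := #|symdiff U U'| + #|symdiff F F'|.

Definition changed r U F U' F' :=
  [set s | [pick e | matched r U F e s] != [pick e | matched r U' F' e s]].

(** An address without discrepancy yields the same match in both runs. At any other address only the
    least free slot of each run can change, hence the factor 2. *)
Lemma card_changed r U F U' F' :
  #|changed r U F U' F'| <= 2 * discrepancy U F U' F'.
Proof.
rewrite (card_fibers (rhash r)) /discrepancy (card_fibers (lhash r) (symdiff U _)).
rewrite (card_fibers (rhash r) (symdiff F _)) -big_split /= big_distrr /=.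
apply: leq_sum => c _; rewrite !fiber_symdiff.
set d := _ + _; have [d0|d_gt0] := posnP d.
  move/eqP: (d0); rewrite addn_eq0 => /andP[/eqP/symdiff_eq0 dU /eqP/symdiff_eq0 dF].
  rewrite d0 muln0 leqn0 cards_eq0; apply/eqP/setP=> s; rewrite in_fiber [in RHS]inE.
  apply/negP=> /andP[]; rewrite inE => /eqP+ /eqP sc; apply.
  apply: eq_pick => e; rewrite /matched; case: eqP => //= es.
  by rewrite es sc dU dF.
apply: (@leq_trans 2); last by rewrite leq_pmulr.
apply: (@leq_trans (#|minset (fiber (rhash r) F c)| +
                    #|minset (fiber (rhash r) F' c)|)); last first.
  by rewrite !card_minset; do 2!case: (_ != _).
apply: leq_trans (leq_card_setU _ _); apply: subset_leq_card.
apply/subsetP=> s; rewrite in_fiber in_setU inE => /andP[+ /eqP sc].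
apply: contraR; rewrite negb_or -sc => /andP[sM sM'].
by apply/eqP/eq_pick => e; rewrite /matched (negbTE sM) (negbTE sM') !andbF.
Qed.

Lemma assign_lipschitz rs U F U' F' :
  #|[set s | assign rs U F s != assign rs U' F' s]|
    <= 2 * size rs * discrepancy U F U' F'.
Proof.
elim: rs U F U' F' => [|r rs IH] U F U' F' /=.
  by rewrite leqn0 cards_eq0; apply/eqP/setP=> s; rewrite !inE.
have le_d := rest_lipschitz (lhash r) (rhash r) U U' F F'.
have le_rs := IH (lrest r U F) (rrest r U F) (lrest r U' F') (rrest r U' F').
rewrite mulnS mulnDl; apply: leq_trans (leq_add (card_changed r U F U' F') _); last first.
  by apply: leq_trans le_rs _; rewrite leq_mul2l le_d orbT.
apply: leq_trans (leq_card_setU _ _); apply: subset_leq_card.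
apply/subsetP=> s; rewrite in_setU !inE -negb_and.
by apply: contra => /andP[/eqP-> /eqP->].
Qed.

End Assignment.

(** * Counting the elements left after a run *)

Section Progress.
Variables n k : nat.
Implicit Types (U W : {set 'I_n}) (F Z : {set 'I_k}) (rs : seq (round n k)).

(* The number of pairs that the round matches when [W] and [Z] remain. *)
Definition hits (r : round n k) W Z := #|lhash r @: W :&: rhash r @: Z|.

Lemma leq_hits r U F W Z : W \subset U -> Z \subset F ->
  hits r W Z <= hits r U F.
Proof.
by move=> WU ZF; apply: subset_leq_card; apply: setISS; apply: imsetS.
Qed.

Lemma card_lrest r U F : #|lrest r U F| + hits r U F = #|U|.
Proof. exact: card_rest. Qed.

Lemma card_rrest r U F : #|rrest r U F| + hits r U F = #|F|.
Proof. by rewrite /hits setIC; apply: card_rest. Qed.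

Lemma run_sub rs U F : (run rs U F).1 \subset U /\ (run rs U F).2 \subset F.
Proof.
elim: rs U F => //= r rs IH U F; have [sU sF] := IH (lrest r U F) (rrest r U F).
by rewrite (subset_trans sU (lrest_sub r U F)) (subset_trans sF (rrest_sub r U F)).
Qed.

Lemma run_card rs U F : #|U| = #|F| -> #|(run rs U F).1| = #|(run rs U F).2|.
Proof.
elim: rs U F => //= r rs IH U F eUF; apply: IH.
by apply: (@addIn (hits r U F)); rewrite card_lrest card_rrest.
Qed.

Lemma run_cat rs rs' U F :
  run (rs ++ rs') U F = run rs' (run rs U F).1 (run rs U F).2.
Proof. by elim: rs U F => //= r rs IH U F; rewrite IH. Qed.

Lemma run_hits rs U F W Z t :
    has (fun r => t <= hits r W Z) rs ->
    W \subset (run rs U F).1 -> Z \subset (run rs U F).2 ->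
  #|(run rs U F).1| + t <= #|U|.
Proof.
elim: rs U F => //= r rs IH U F; rewrite -(card_lrest r U F).
have [sU sF] := run_sub rs (lrest r U F) (rrest r U F).
case/orP=> [tr|/IH{}IH] WU ZF.
  apply: leq_add; first exact: subset_leq_card.
  apply: leq_trans tr (leq_hits _ _ _).
    exact: subset_trans (subset_trans WU sU) (lrest_sub _ _ _).
  exact: subset_trans (subset_trans ZF sF) (rrest_sub _ _ _).
exact: leq_trans (IH _ _ WU ZF) (leq_addr _ _).
Qed.

Lemma subset_of_card (T : finType) (X : {set T}) v :
  v <= #|X| -> exists2 Y : {set T}, Y \subset X & #|Y| = v.
Proof.
move=> vX; have : 0 < 'C(#|X|, v) by rewrite bin_gt0.
rewrite -cards_draws card_gt0 => /set0Pn[Y].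
by rewrite inE => /andP[YX /eqP Yv]; exists Y.
Qed.

(** While [v] elements survive a block, so do [v] slots, and any surviving [W] and [Z] of that size
    certify a loss of at least [t]. *)
Lemma run_repeat rs v t b :
    (forall W Z, #|W| = v -> #|Z| = v -> has (fun r => t <= hits r W Z) rs) ->
  forall U F, #|U| = #|F| -> #|U| < v + b * t ->
  #|(run (flatten (nseq b rs)) U F).1| < v.
Proof.
move=> rsP; elim: b => [|b IH] U F eUF /=; first by rewrite addn0.
rewrite run_cat => ltU; have [lt_v|ge_v] := ltnP #|(run rs U F).1| v.
  by apply: leq_ltn_trans lt_v; apply: subset_leq_card; exact: (run_sub _ _ _).1.
apply: IH; first exact: run_card.
have [W WU Wv] := subset_of_card ge_v.
have [Z ZF Zv] : exists2 Z : {set 'I_k}, Z \subset (run rs U F).2 & #|Z| = v.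
  by apply: subset_of_card; rewrite -run_card.
rewrite -(ltn_add2r t) -addnA -mulSnr.
exact: leq_ltn_trans (run_hits (rsP W Z Wv Zv) WU ZF) ltU.
Qed.

End Progress.

(** * Existence of good hash functions *)

(* Derandomized union bound, for failure probability [2 ^- e] per trial: some
   [a] is bad for at most a [2 ^- e] fraction of the surviving targets. *)
Lemma greedy_cover (A B : finType) (bad : A -> B -> bool) e l (P : {set B}) :
    0 < #|A| -> (forall b, b \in P -> #|[set a | bad a b]| * 2 ^ e <= #|A|) ->
    #|P| < 2 ^ (e * l) ->
  exists2 s : seq A, size s = l &
    forall b, b \in P -> has (fun a => ~~ bad a b) s.
Proof.
move=> A0; elim: l P => [|l IH] P badP.
  rewrite muln0 expn0 ltnS leqn0 cards_eq0 => /eqP->.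
  by exists [::] => // b; rewrite inE.
move=> ltP; pose Q a := [set b in P | bad a b].
have [a Qa] : exists a, #|Q a| * 2 ^ e <= #|P|.
  (* Double counting of the bad pairs: otherwise their number, times [2 ^ e], would exceed
     [#|A| * #|P|]. *)
  apply/existsP; apply: contraT; rewrite negb_exists => /forallP gtQ.
  suff : #|A| * #|P|.+1 <= #|A| * #|P| by rewrite leq_pmul2l // ltnn.
  apply: (@leq_trans (\sum_a #|Q a| * 2 ^ e)).
    rewrite -sum_nat_const; apply: leq_sum => a _.
    by rewrite ltnNge gtQ.
  rewrite -big_distrl /=.
  have -> : \sum_a #|Q a| = \sum_(b in P) #|[set a | bad a b]|.
    rewrite (eq_bigr (fun a => \sum_(b in P) bad a b)); last first.
      by move=> a _; rewrite -sum1_card big_mkcond /= [RHS]big_mkcond;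
         apply: eq_bigr => b _; rewrite inE; case: (b \in P); case: (bad a b).
    rewrite exchange_big; apply: eq_bigr => b _.
    rewrite -sum1_card [RHS]big_mkcond; apply: eq_bigr => a _.
    by rewrite inE; case: (bad a b).
  rewrite big_distrl /= mulnC -sum_nat_const.
  by apply: leq_sum => b /badP.
have [||s ss sP] := IH (Q a).
- by move=> b; rewrite inE => /andP[/badP].
- have e0 : 0 < 2 ^ e by rewrite expn_gt0.
  rewrite -(ltn_pmul2r e0); apply: leq_ltn_trans Qa _.
  by rewrite -expnD -mulnSr.
exists (a :: s) => [/=|b bP /=]; first by rewrite ss.
case: (boolP (bad a b)) => //= bab; apply: sP; rewrite inE bP //=.
Qed.

Lemma card_ffun_imset_sub m w (X : {set 'I_m}) (T : {set 'I_w}) :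
  #|[set h : {ffun 'I_m -> 'I_w} | h @: X \subset T]|
    = #|T| ^ #|X| * w ^ (m - #|X|).
Proof.
pose D i : pred 'I_w := [pred j | (i \in X) ==> (j \in T)].
transitivity #|(family D : pred {ffun 'I_m -> 'I_w})|.
  apply: eq_card => h; rewrite inE; apply/subsetP/familyP => [hX i|hX j].
    by rewrite inE /=; apply/implyP => iX; apply: hX; apply: imset_f.
  by case/imsetP=> i iX ->; have := hX i; rewrite inE /= iX.
rewrite card_family foldrE big_map big_enum /= (bigID (mem X)) /=.
congr (_ * _).
  rewrite (eq_bigr (fun=> #|T|)) ?prod_nat_const // => i iX.
  by apply: eq_card => j; rewrite inE /= iX.
rewrite (eq_bigr (fun=> w)) => [|i iX].
  rewrite prod_nat_const; congr (_ ^ _).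
  have -> : m - #|X| = #|~: X| by rewrite [RHS]cardsCs setCK card_ord.
  by apply: eq_card => i; rewrite inE.
by rewrite -[RHS]card_ord; apply: eq_card => j; rewrite inE /= (negbTE iX).
Qed.

Lemma leq_expn_base a b e : a <= b -> a ^ e <= b ^ e.
Proof. by case: e => // e ab; rewrite leq_exp2r. Qed.

(** Union bound over the at most [2 ^ (4 * q)] sets [T] that may contain the image, each doing so
    with probability at most [(3/4) ^ (20 * q)]. *)
Lemma card_small_image m q (X : {set 'I_m}) : #|X| = 20 * q ->
  #|[set h : {ffun 'I_m -> 'I_(4 * q)} | #|h @: X| <= 3 * q]| * 2 ^ (4 * q)
    <= (4 * q) ^ m.
Proof.
move=> Xq; have le_m : 20 * q <= m by rewrite -Xq -[X in _ <= X]card_ord max_card.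
(* This is the [4 * q]-th power of [2^2 * 3^5 = 972 <= 1024 = 4^5]. One factor [2 ^ (4 * q)] pays
   for the choice of [T], the other is the gain claimed. *)
have num : 2 ^ (8 * q) * (3 * q) ^ (20 * q) <= (4 * q) ^ (20 * q).
  rewrite !expnMn mulnA leq_mul2r; apply/orP; right.
  have -> : 8 * q = 2 * (4 * q) by lia.
  have -> : 20 * q = 5 * (4 * q) by lia.
  by rewrite !(expnM _ _ (4 * q)) -expnMn; apply: leq_expn_base.
pose S := [set h : {ffun 'I_m -> 'I_(4 * q)} | #|h @: X| <= 3 * q].
have leS : #|S| <= 2 ^ (4 * q) * ((3 * q) ^ (20 * q) * (4 * q) ^ (m - 20 * q)).
  pose K (T : {set 'I_(4 * q)}) := [set h : {ffun 'I_m -> 'I_(4 * q)} | h @: X \subset T].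
  apply: (@leq_trans (\sum_(T : {set 'I_(4 * q)} | #|T| <= 3 * q) #|K T|)).
    rewrite -[#|S|]sum1_card.
    rewrite (eq_bigr (fun T => \sum_(h in K T) 1)) => [|T _]; last first.
      by rewrite sum1_card.
    rewrite (exchange_big_dep predT) //= [leqLHS]big_mkcond /=.
    apply: leq_sum => h _; rewrite inE; case: ifP => // le_hX.
    (* Each such [h] is counted at least for [T] equal to its own image. *)
    by rewrite (bigD1 (h @: X)) //= le_hX inE subxx.
  rewrite -[X in 2 ^ X]card_ord -cardsT -card_powerset powersetT cardsT.
  rewrite -sum_nat_const big_mkcond.
  apply: leq_sum => T _; case: ifP => // leT.
  by rewrite card_ffun_imset_sub Xq leq_mul2r leq_expn_base ?orbT.
apply: leq_trans (leq_mul leS (leqnn _)) _.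
rewrite -[m in X in _ <= X](subnKC le_m) expnD.
apply: leq_trans (leq_mul num (leqnn _)); rewrite -[8]/(4 + 4) mulnDl expnD.
by rewrite mulnC !mulnA.
Qed.

Lemma leq_bin_exp n v : 'C(n, v) <= n ^ v.
Proof.
apply: (@leq_trans (n ^_ v)); first by rewrite -bin_ffact leq_pmulr ?fact_gt0.
elim: v => // v IH; rewrite ffactnSr expnSr.
by apply: leq_mul; rewrite ?leq_subr.
Qed.

(** * A schedule of rounds that places everything *)

Section Schedule.
Variables n k : nat.
Implicit Types rs : seq (round n k).

Lemma good_block q L : 0 < q -> 0 < L -> k <= n -> n <= 2 ^ L ->
  exists2 rs, size rs = 14 * L &
    forall (W : {set 'I_n}) (Z : {set 'I_k}), #|W| = 20 * q -> #|Z| = 20 * q ->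
      has (fun r => 2 * q <= hits r W Z) rs.
Proof.
move=> q0 L0 le_kn le_n.
pose A := ({ffun 'I_n -> 'I_(4 * q)} * {ffun 'I_k -> 'I_(4 * q)})%type.
pose B := ({set 'I_n} * {set 'I_k})%type.
pose bad (a : A) (b : B) := (#|a.1 @: b.1| <= 3 * q) || (#|a.2 @: b.2| <= 3 * q).
pose P := setX [set W : {set 'I_n} | #|W| == 20 * q]
               [set Z : {set 'I_k} | #|Z| == 20 * q].
have cA : #|{: A}| = (4 * q) ^ n * (4 * q) ^ k.
  by rewrite card_prod !card_ffun !card_ord.
have [|b||s ss sP] := @greedy_cover A B bad (3 * q) (14 * L) P.
- by rewrite cA muln_gt0 !expn_gt0 muln_gt0 q0.
- rewrite !inE => /andP[/eqP b1 /eqP b2]; rewrite cA.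
  pose S1 := [set h : {ffun 'I_n -> 'I_(4 * q)} | #|h @: b.1| <= 3 * q].
  pose S2 := [set h : {ffun 'I_k -> 'I_(4 * q)} | #|h @: b.2| <= 3 * q].
  have c1 : #|S1| * 2 ^ (4 * q) <= (4 * q) ^ n := card_small_image b1.
  have c2 : #|S2| * 2 ^ (4 * q) <= (4 * q) ^ k := card_small_image b2.
  have leS : #|[set a | bad a b]| <= #|S1| * (4 * q) ^ k + (4 * q) ^ n * #|S2|.
    have -> : #|S1| * (4 * q) ^ k = #|setX S1 [set: {ffun 'I_k -> 'I_(4 * q)}]|.
      by rewrite cardsX cardsT card_ffun !card_ord.
    have -> : (4 * q) ^ n * #|S2| = #|setX [set: {ffun 'I_n -> 'I_(4 * q)}] S2|.
      by rewrite cardsX cardsT card_ffun !card_ord.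
    apply: leq_trans (leq_card_setU _ _); apply: subset_leq_card.
    by apply/subsetP=> a; rewrite !inE andbT.
  (* Lowering the exponent from [4 * q] to [3 * q] absorbs the factor 2 for the two hashes. *)
  have le2 : 2 ^ (3 * q) * 2 <= 2 ^ (4 * q) by rewrite -expnSr leq_exp2l; lia.
  move: c1 c2 leS le2; move: #|S1| #|S2| #|[set a | bad a b]| (_ ^ n) (_ ^ k).
  move: (2 ^ (3 * q)) (2 ^ (4 * q)) => x y s1 s2 z u v c1 c2 leS le2.
  have d1 : s1 * y * v <= u * v by rewrite leq_mul2r c1 orbT.
  have d2 : u * (s2 * y) <= u * v by rewrite leq_mul2l c2 orbT.
  have d3 : z * (x * 2) <= (s1 * v + u * s2) * y by apply: leq_mul.
  lia.
(* There are at most [n ^ (40 * q)] pairs, and [3 * 14 = 42 > 40]. *)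
- have lt : 40 * q * L < 3 * q * (14 * L).
    have : 0 < q * L by rewrite muln_gt0 q0.
    lia.
  apply: (@leq_ltn_trans (2 ^ (40 * q * L))); last by rewrite ltn_exp2l.
  rewrite cardsX !card_draws !card_ord.
  apply: leq_trans (leq_mul (leq_bin_exp _ _) (leq_bin_exp _ _)) _.
  have le_k : k ^ (20 * q) <= n ^ (20 * q) by apply: leq_expn_base.
  apply: leq_trans (leq_mul (leqnn _) le_k) _; rewrite -expnD.
  have -> : 20 * q + 20 * q = 40 * q by lia.
  by rewrite [40 * q * L]mulnC (expnM 2 L) leq_expn_base.
exists [seq @Round n k (4 * q) a.1 a.2 | a : A <- s]; first by rewrite size_map.
move=> W Z Wq Zq; rewrite has_map.
have := sP (W, Z); rewrite !inE Wq Zq eqxx => /(_ isT).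
apply: sub_has => a /=; rewrite /bad negb_or -!ltnNge /hits /= => /andP[lt1 lt2].
(* Two sets of more than [3 * q] among [4 * q] addresses share at least [2 * q]. *)
have := cardsUI (a.1 @: W) (a.2 @: Z).
have := max_card (a.1 @: W :|: a.2 @: Z); rewrite card_ord.
move: lt1 lt2; move: #|_ @: W| #|_ @: Z| #|_ :|: _| #|_ :&: _|; lia.
Qed.

Definition one_address : round n k := Round (fun=> ord0 : 'I_1) (fun=> ord0).

Lemma one_address_hits (W : {set 'I_n}) (Z : {set 'I_k}) :
  #|W| = 1 -> #|Z| = 1 -> has (fun r => 1 <= hits r W Z) [:: one_address].
Proof.
move=> W1 Z1; rewrite /= orbF card_gt0; apply/set0Pn; exists ord0.
have [w wW] : exists w, w \in W by apply/set0Pn; rewrite -card_gt0 W1.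
have [z zZ] : exists z, z \in Z by apply/set0Pn; rewrite -card_gt0 Z1.
by rewrite inE; apply/andP; split; apply/imsetP; [exists w | exists z].
Qed.

Lemma halving_schedule L I : 0 < L -> k <= n -> n <= 2 ^ L ->
  exists2 rs, size rs = 140 * L * I &
    forall (U : {set 'I_n}) (F : {set 'I_k}),
      #|U| = #|F| -> #|U| < 20 * 2 ^ I -> #|(run rs U F).1| < 20.
Proof.
move=> L0 le_kn le_n; elim: I => [|I [rs rss rsP]].
  by exists [::]; rewrite ?muln0 //= => U F _; rewrite muln1.
have [|bs bss bsP] := @good_block (2 ^ I) L _ L0 le_kn le_n; first by rewrite expn_gt0.
exists (flatten (nseq 10 bs) ++ rs).
  rewrite size_cat size_flatten /shape map_nseq sumn_nseq bss rss; lia.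
move=> U F eUF ltU; rewrite run_cat; apply: rsP; first exact: run_card.
(* Ten blocks suffice: [20 * 2 ^ I.+1 = 20 * 2 ^ I + 10 * (2 * 2 ^ I)]. *)
apply: run_repeat bsP _ _ eUF _; move: ltU; rewrite expnS; lia.
Qed.

Lemma schedule L I : 0 < L -> 0 < I -> k <= n -> n <= 2 ^ L -> k <= 2 ^ I ->
  exists2 rs, size rs <= 160 * L * I &
    forall U : {set 'I_n}, #|U| = k -> (run rs U [set: 'I_k]).2 = set0.
Proof.
move=> L0 I0 le_kn le_n le_k.
have [rs rss rsP] := halving_schedule I L0 le_kn le_n.
exists (rs ++ flatten (nseq 20 [:: one_address])).
  rewrite size_cat size_flatten /shape map_nseq sumn_nseq rss /=.
  by have : 0 < L * I; [rewrite muln_gt0 L0 | lia].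
move=> U Uk; have eUT : #|U| = #|[set: 'I_k]| by rewrite cardsT card_ord.
have ltU : #|U| < 20 * 2 ^ I by have : 0 < 2 ^ I; [rewrite expn_gt0 | lia].
(* Equally many elements and slots remain, so it is enough to place all elements. *)
apply/eqP; rewrite -cards_eq0 -run_card // -leqn0 -ltnS run_cat.
have ltr := rsP _ _ eUT ltU.
apply: run_repeat one_address_hits _ _ _ _; first exact: run_card.
by rewrite ltnS muln1 ltnW.
Qed.

End Schedule.

(** * The embedding, and the passage to real logarithms *)

Import Order.TTheory GRing.Theory Num.Theory.

Lemma slice_embedding n k L I : 1 < k -> 0 < L -> 0 < I -> k <= n ->
    n <= 2 ^ L -> k <= 2 ^ I ->
  exists phi : slice n k -> hamming_space k n, forall x y : slice n k,
    Ham (val x) (val y) <= 2 * Ham (phi x) (phi y) /\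
    Ham (phi x) (phi y) <= 320 * L * I * Ham (val x) (val y).
Proof.
move=> k1 L0 I0 le_kn le_n le_k.
have [rs rss rsP] := schedule L0 I0 le_kn le_n le_k.
pose supp (x : slice n k) := [set i | val x i].
have suppk x : #|supp x| = k by apply/eqP; exact: (valP x).
have n0 : 0 < n by lia.
(* The default is never taken: the schedule fills every slot, as [phiE] records. *)
pose phi x := [ffun s => odflt (Ordinal n0) (assign rs (supp x) setT s)].
have phiE x s : assign rs (supp x) setT s = Some (phi x s).
  rewrite ffunE; have [|e ->] // := @assign_run _ _ rs (supp x) setT s (in_setT s).
  by rewrite rsP ?suppk // inE.
have HamE (x y : slice n k) : Ham (val x) (val y) = #|symdiff (supp x) (supp y)|.
  by apply: eq_card => i; rewrite in_symdiff !inE.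
exists phi => x y; split; last first.
  apply: (@leq_trans (2 * size rs * #|symdiff (supp x) (supp y)|)).
    (* Both runs start with all slots free, so the initial discrepancy comes from the supports
       alone. *)
    have := assign_lipschitz rs (supp x) setT (supp y) setT.
    rewrite /discrepancy symdiffv cards0 addn0; apply: leq_trans.
    by apply: subset_leq_card; apply/subsetP=> s; rewrite !inE !phiE.
  rewrite HamE leq_mul2r; apply/orP; right; lia.
(* [phi z] is injective and maps the slots of agreement into the common support, so at least
   [k - #|supp z :&: supp t|] slots disagree. *)
have half z t : #|supp z :\: supp t| <= Ham (phi z) (phi t).
  pose G := [set s | phi z s == phi t s].
  have leG : #|G| <= #|supp z :&: supp t|.
    rewrite -(card_in_imset (f := phi z) (D := mem G)); last first.
      move=> s s' _ _ e; apply: assign_inj (phiE z s) _.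
      by rewrite phiE e.
    apply: subset_leq_card; apply/subsetP=> _ /imsetP[s sG ->].
    rewrite inE (assign_mem (phiE z s)).1 /=.
    by move: sG; rewrite inE => /eqP ->; exact: (assign_mem (phiE t s)).1.
  have -> : Ham (phi z) (phi t) = #|~: G|.
    by apply: eq_card => s; rewrite !inE.
  rewrite -(leq_add2l #|G|) cardsC card_ord.
  rewrite -[X in _ <= X](suppk z) -(cardsID (supp t) (supp z)).
  by rewrite leq_add2r.
rewrite HamE mul2n -addnn; apply: leq_trans (leq_card_setU _ _) _.
apply: leq_add; first exact: half.
have -> : Ham (phi x) (phi y) = Ham (phi y) (phi x).
  by apply: eq_card => s; rewrite !inE eq_sym.
exact: half.
Qed.

Local Open Scope ring_scope.

Lemma ln2_gt0 (R : realType) : 0 < ln 2 :> R.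
Proof. by rewrite ln_gt0 // ltr1n. Qed.

(** Rounding up adds at most 1 to the binary logarithm, which is itself at least 1 here. *)
Lemma up_log2_ln (R : realType) n : (2 <= n)%N ->
  (up_log 2 n)%:R * ln 2 <= 2 * ln n%:R :> R.
Proof.
move=> n2; have l0 : (0 < up_log 2 n)%N by rewrite up_log_gt0.
have /andP[lt_n _] : (2 ^ (up_log 2 n).-1 < n <= 2 ^ up_log 2 n)%N.
  exact: up_log_bounds.
have le1 : (up_log 2 n).-1%:R * ln 2 <= ln n%:R :> R.
  rewrite mulrC mulr_natr -lnXn // ler_ln ?posrE ?exprn_gt0 ?ltr0n //; last by lia.
  by rewrite -natrX ler_nat ltnW.
have le2 : ln 2 <= ln n%:R :> R.
  by rewrite ler_ln ?posrE ?ltr0n ?ler_nat //; lia.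
by rewrite -(prednK l0) -natr1 mulrDl mul1r [2 * _]mulr_natl mulr2n lerD.
Qed.

Theorem theorem4 (R : realType) :
  exists C : R, 0 < C /\
    forall n k : nat, (2 <= k)%N -> (k <= n)%N ->
      exists phi : slice n k -> hamming_space k n,
        forall x y : slice n k,
          2^-1 * (Ham (val x) (val y))%:R <= (Ham (phi x) (phi y))%:R :> R /\
          (Ham (phi x) (phi y))%:R
            <= C * ln n%:R * ln k%:R * (Ham (val x) (val y))%:R :> R.
Proof.
pose c : R := ln 2; have c0 : 0 < c := ln2_gt0 R.
(* Each factor [2 / c] converts one rounded binary logarithm into [ln]. *)
exists (320 * (2 / c) * (2 / c)); split.
  by rewrite !mulr_gt0 ?invr_gt0 ?ltr0n.
move=> n k k2 le_kn; have n2 := leq_trans k2 le_kn.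
have up_gt0 m : (1 < m -> 0 < up_log 2 m)%N by rewrite up_log_gt0.
have [phi phiP] := slice_embedding k2 (up_gt0 n n2) (up_gt0 k k2) le_kn
  (@up_logP 2 n isT) (@up_logP 2 k isT).
exists phi => x y; have [lo up] := phiP x y; split.
  by rewrite ler_pdivrMl ?ltr0n // -natrM ler_nat.
apply: le_trans (_ : (320 * up_log 2 n * up_log 2 k * Ham (val x) (val y))%:R <= _).
  by rewrite ler_nat.
have leln m : (1 < m)%N -> (up_log 2 m)%:R <= 2 / c * ln m%:R.
  by move=> m1; rewrite mulrAC ler_pdivlMr // up_log2_ln.
rewrite !natrM ler_wpM2r ?ler0n //.
have -> : 320 * (2 / c) * (2 / c) * ln n%:R * ln k%:R
        = 320 * (2 / c * ln n%:R) * (2 / c * ln k%:R).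
  by move: (2 / c) => a; rewrite -!(mulrA 320) -(mulrA (a * a)) mulrACA.
apply: ler_pM; rewrite ?mulr_ge0 ?ler0n ?leln //.
by rewrite ler_wpM2l ?ler0n ?leln.
Qed.
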